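(* Let $S=\{u_1,\ldots,u_k\}\subseteq\mathbb{R}^n$ be a set of $k$ points with $k\le n+1$, and let $$U=\big[\,u_1-u_k\ \ \cdots\ \ u_{k-1}-u_k\,\big]\in\mathbb{R}^{n\times(k-1)}.$$ Suppose $\operatorname{rank}U=k-1$, and let $U^\dagger=(U^TU)^{-1}U^T$. Then the function $$f(x)=F_{k-1}\big(U^\dagger(x-u_k)\big),\qquad x\in\mathbb{R}^n,$$ is a loss function for the set $$S+\mathrm{Null}(U^\dagger)=\{x+y:\ x\in S,\ U^\dagger y=0\}.$$ Moreover, $f$ has no spurious minimizers.
   Context: For $z=(z_1,\ldots,z_{k-1})\in\mathbb{R}^{k-1}$, $$F_{k-1}(z)=\sum_{i=1}^{k-1}z_i^2(z_i-1)^2+\sum_{1\le i<j\le k-1}z_i^2z_j^2.$$ A function $f$ on $\mathbb{R}^n$ is a loss function for a set $A\subseteq\mathbb{R}^n$ if the global minimizers of $f$ are precisely the points of $A$; loss functions are here normalized to be nonnegative with minimum value zero, so this means $f\ge 0$ on $\mathbb{R}^n$ and $f(x)=0$ if and only if $x\in A$. A spurious minimizer is a local minimizer that is not a global minimizer. $\mathrm{Null}(U^\dagger)$ is the null space of $U^\dagger$. *)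

(* Defs.v *)
From mathcomp Require Import all_boot all_order all_algebra.
From mathcomp Require Import all_classical all_reals all_analysis.

Set Implicit Arguments.
Unset Strict Implicit.
Unset Printing Implicit Defensive.

Import Order.TTheory GRing.Theory Num.Theory.
Import numFieldNormedType.Exports.

Local Open Scope classical_set_scope.
Local Open Scope ring_scope.

Definition global_minimizer (R : realType) (n : nat)
    (f : 'cV[R]_n -> R) (x : 'cV[R]_n) : Prop :=
  forall y, f x <= f y.

(* [nbhs] on ['cV[R]_n] is the product topology, i.e. the usual topology of
   R^n. *)
Definition local_minimizer (R : realType) (n : nat)
    (f : 'cV[R]_n -> R) (x : 'cV[R]_n) : Prop :=
  \forall y \near x, f x <= f y.

Definition spurious_minimizer (R : realType) (n : nat)
    (f : 'cV[R]_n -> R) (x : 'cV[R]_n) : Prop :=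
  local_minimizer f x /\ ~ global_minimizer f x.

(* Loss functions are normalized to have minimum value zero. *)
Definition loss_function (R : realType) (n : nat)
    (f : 'cV[R]_n -> R) (A : set 'cV[R]_n) : Prop :=
  (forall x, 0 <= f x) /\ (forall x, f x = 0 <-> A x).

Definition F_poly (R : realType) (m : nat) (z : 'cV[R]_m) : R :=
  \sum_(i < m) z i 0 ^+ 2 * (z i 0 - 1) ^+ 2
  + \sum_(i < m) \sum_(j < m | (i < j)%N) z i 0 ^+ 2 * z j 0 ^+ 2.

(* With k = m + 1 points indexed from 0, [u ord_max] is u_k and column [j] is
   u_{j+1} - u_k. *)
Definition diff_mx (R : realType) (n m : nat)
    (u : 'I_m.+1 -> 'cV[R]_n) : 'M[R]_(n, m) :=
  \matrix_(i < n, j < m)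
    (u (widen_ord (leqnSn m) j) - u ord_max) i 0.

(* [invmx] is a genuine inverse here only when [U] has full column rank. *)
Definition left_pinv (R : realType) (n m : nat) (U : 'M[R]_(n, m)) :
    'M[R]_(m, n) :=
  invmx (U^T *m U) *m U^T.

Definition null_space (R : realType) (m n : nat) (A : 'M[R]_(m, n)) :
    set 'cV[R]_n :=
  [set y | A *m y = 0].

(* Main.v *)
(** The second-order test along the coordinate axes already singles out the
    zeros of [F_poly].  Write [w := z_i] and let [s] be the sum of the other
    [z_j ^ 2].  At a minimum along axis [i] with [w != 0], the first-order
    condition gives [s = - (w - 1) * (2 * w - 1)], so [w >= 1 / 2] and
    [s <= 1 / 8]; the second-order condition then improves this to
    [w >= 3 / 4].  Two nonzero coordinates would force [s >= 9 / 16], so at most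
    one is nonzero, and then [s = 0] leaves only [w = 1].  Since
    [left_pinv U *m U = 1], moving [x] along column [i] of [U] moves [z] along
    axis [i], which transfers this to [f]. *)
Require Import Defs.
From mathcomp Require Import all_boot all_order all_algebra.
From mathcomp Require Import all_classical all_reals all_analysis.
From mathcomp Require Import ring lra.
Set Implicit Arguments.
Unset Strict Implicit.
Import Order.TTheory GRing.Theory Num.Theory.
Import numFieldNormedType.Exports.
Local Open Scope classical_set_scope.
Local Open Scope ring_scope.

(** * One-variable derivative tests for polynomials *)

Lemma affine_ge0_at0 (R : realFieldType) (a K e : R) : 0 < e -> 0 <= K ->
  (forall t, 0 < t -> t < e -> 0 <= a + K * t) -> 0 <= a.
Proof.
move=> e0 K0 h; rewrite leNgt; apply/negP => a0.
(* The second bound gives [K * t < - a / 2], hence [a + K * t < 0]; the [+ 1] covers [K = 0]. *)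
pose t := Num.min (e / 2) (- a / (2 * (K + 1))).
have d0 : 0 < 2 * (K + 1) by lra.
have t0 : 0 < t by rewrite lt_min !divr_gt0 ?oppr_gt0.
have te : t < e.
  by apply: (@le_lt_trans _ _ (e / 2)); [rewrite ge_min lexx | lra].
have ta : t * (2 * (K + 1)) <= - a.
  by rewrite -ler_pdivlMr // ge_min lexx orbT.
have := h t t0 te; nra.
Qed.

(** For [0 < t < 1] every higher power of [t] is at most [t], which reduces the cubic to an affine
    bound. *)
Lemma cubic_ge0_at0 (R : realFieldType) (a b c d e : R) : 0 < e ->
  (forall t, 0 < t -> t < e -> 0 <= a + b * t + c * t ^+ 2 + d * t ^+ 3) ->
  0 <= a.
Proof.
move=> e0 h.
apply: (@affine_ge0_at0 _ a (`|b| + `|c| + `|d|) (Num.min e 1)).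
- by rewrite lt_min e0 ltr01.
- by rewrite !addr_ge0.
move=> t t0; rewrite lt_min => /andP[te t1].
apply: le_trans (h t t0 te) _; rewrite -!addrA lerD2l !mulrDl.
have bound (x : R) (k : nat) : x * t ^+ k.+1 <= `|x| * t.
  apply: le_trans (ler_norm _) _; rewrite normrM ler_wpM2l //.
  have t0' := ltW t0; have t1' := ltW t1.
  by rewrite ger0_norm ?exprn_ge0 // exprS ler_piMr ?exprn_ile1.
by rewrite !lerD //; apply: (bound _ 0%N).
Qed.

(** Dividing by [t] on each side of 0 gives [0 <= a] and [0 <= - a]; once [a = 0], dividing by [t]
    again gives [0 <= b]. *)
Lemma quartic_local_min (R : realFieldType) (a b c d e : R) : 0 < e ->
  (forall t, `|t| < e ->
    0 <= a * t + b * t ^+ 2 + c * t ^+ 3 + d * t ^+ 4) ->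
  a = 0 /\ 0 <= b.
Proof.
move=> e0 h.
have pos (t : R) : 0 < t -> t < e -> 0 <= a + b * t + c * t ^+ 2 + d * t ^+ 3.
  move=> t0 te; rewrite -(pmulr_rge0 _ t0).
  by have := h t; rewrite gtr0_norm // => /(_ te); congr (0 <= _); ring.
have neg (t : R) : 0 < t -> t < e ->
    0 <= - a + b * t + (- c) * t ^+ 2 + d * t ^+ 3.
  move=> t0 te; rewrite -(pmulr_rge0 _ t0).
  have := h (- t); rewrite normrN gtr0_norm // => /(_ te).
  by congr (0 <= _); ring.
have a0 : a = 0.
  have := cubic_ge0_at0 e0 pos; have := cubic_ge0_at0 e0 neg; lra.
split=> //; apply: (cubic_ge0_at0 (b := c) (c := d) (d := 0) e0) => t t0 te.
rewrite -(pmulr_rge0 _ t0).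
by have := pos t t0 te; rewrite a0; congr (0 <= _); ring.
Qed.

(** * [F_poly] along the coordinate axes *)

Lemma sum_lt_mul (R : comPzRingType) (m : nat) (a : 'I_m -> R) :
  (\sum_(i < m) \sum_(j < m | (i < j)%N) a i * a j) *+ 2 =
  (\sum_i a i) ^+ 2 - \sum_i a i ^+ 2.
Proof.
apply/eqP; rewrite eq_sym subr_eq; apply/eqP.
rewrite expr2 mulr_suml mulr2n.
under eq_bigr do rewrite mulr_sumr.
have gt_lt : \sum_(i < m) \sum_(j < m | (j < i)%N) a i * a j =
    \sum_(i < m) \sum_(j < m | (i < j)%N) a i * a j.
  rewrite (exchange_big_dep predT) //=.
  by apply: eq_bigr => i _; apply: eq_bigr => j _; rewrite mulrC.
rewrite -{2}gt_lt -!big_split /=; apply: eq_bigr => i _.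
rewrite (bigID (fun j : 'I_m => (i < j)%N)) /= -addrA; congr (_ + _).
rewrite (bigD1 i) ?ltnn //= addrC expr2; congr (_ + _).
by apply: eq_bigl => j; rewrite -leqNgt ltn_neqAle andbC.
Qed.

Definition off_norm2 (R : realType) (m : nat) (z : 'cV[R]_m) (i : 'I_m) : R :=
  \sum_(j < m | j != i) z j 0 ^+ 2.

(** Doubling removes the order constraint [i < j], so any single coordinate can be split off the
    sums. *)
Lemma F_polyE (R : realType) (m : nat) (z : 'cV[R]_m) :
  F_poly z *+ 2 = (\sum_i z i 0 ^+ 2 * (z i 0 - 1) ^+ 2) *+ 2 +
    (\sum_i z i 0 ^+ 2) ^+ 2 - \sum_i z i 0 ^+ 4.
Proof.
rewrite /F_poly mulrnDl (sum_lt_mul (fun i => z i 0 ^+ 2)) addrA.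
by congr (_ - _); apply: eq_bigr => i _; rewrite -exprM.
Qed.

(** Exact Taylor expansion along axis [i], in the shape that [quartic_local_min] expects. *)
Lemma F_poly_perturb (R : realType) (m : nat) (z : 'cV[R]_m) (i : 'I_m)
    (t : R) :
  let w := z i 0 in let s := off_norm2 z i in
  F_poly (z + t *: delta_mx i 0) - F_poly z =
  (2 * (w * (w - 1) * (2 * w - 1) + s * w)) * t +
  (6 * w ^+ 2 - 6 * w + 1 + s) * t ^+ 2 + (4 * w - 2) * t ^+ 3 + 1 * t ^+ 4.
Proof.
move=> w s.
have zi : (z + t *: delta_mx i 0) i 0 = w + t by rewrite !mxE !eqxx mulr1.
have zj (j : 'I_m) : j != i -> (z + t *: delta_mx i 0) j 0 = z j 0.
  by move=> ji; rewrite !mxE (negbTE ji) mulr0 addr0.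
have off (g : R -> R) :
    \sum_(j < m | j != i) g ((z + t *: delta_mx i 0) j 0) =
    \sum_(j < m | j != i) g (z j 0).
  by apply: eq_bigr => j ji; rewrite zj.
have two0 : (2%:R : R) != 0 by rewrite pnatr_eq0.
apply: (mulIf two0); rewrite !mulr_natr mulrnBl !F_polyE.
rewrite !(bigD1 (P := predT) i) //= zi.
rewrite (off (fun x => x ^+ 2)) (off (fun x => x ^+ 4)).
rewrite (off (fun x => x ^+ 2 * (x - 1) ^+ 2)) -/w -/(off_norm2 z i) -/s.
ring.
Qed.

Lemma F_poly_ge0 (R : realType) (m : nat) (z : 'cV[R]_m) : 0 <= F_poly z.
Proof.
apply: addr_ge0; apply: sumr_ge0 => i _; first by rewrite mulr_ge0 ?sqr_ge0.
by apply: sumr_ge0 => j _; rewrite mulr_ge0 ?sqr_ge0.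
Qed.

Lemma F_poly0 (R : realType) (m : nat) : F_poly (0 : 'cV[R]_m) = 0.
Proof.
rewrite /F_poly !big1 ?addr0 // => i _.
  by rewrite big1 // => j _; rewrite mxE expr0n mul0r.
by rewrite mxE expr0n mul0r.
Qed.

Lemma F_poly_coord_min_neq0 (R : realType) (m : nat) (z : 'cV[R]_m) (i : 'I_m)
    (e : R) : 0 < e ->
  (forall t, `|t| < e -> F_poly z <= F_poly (z + t *: delta_mx i 0)) ->
  z i 0 != 0 ->
  3 / 4 <= z i 0 /\
  off_norm2 z i = - ((z i 0 - 1) * (2 * z i 0 - 1)).
Proof.
move=> e0 h z0.
set w := z i 0 in z0 *; set s := off_norm2 z i.
have incr (t : R) : `|t| < e ->
    0 <= (2 * (w * (w - 1) * (2 * w - 1) + s * w)) * t +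
      (6 * w ^+ 2 - 6 * w + 1 + s) * t ^+ 2 + (4 * w - 2) * t ^+ 3 +
      1 * t ^+ 4.
  by move=> te; rewrite -F_poly_perturb subr_ge0; apply: h.
have [crit hess] := quartic_local_min e0 incr.
have crit' : (w - 1) * (2 * w - 1) + s = 0.
  by apply: (mulfI z0); lra.
have s0 : 0 <= s by apply: sumr_ge0 => j _; rewrite sqr_ge0.
have sE : s = - ((w - 1) * (2 * w - 1)) by lra.
(* Substituting [s] turns [hess] into [0 <= w * (4 * w - 3)], while [0 <= s] puts [w] between 1/2
   and 1. *)
by split=> //; move: hess s0; rewrite sE; nra.
Qed.

Lemma F_poly_delta (R : realType) (m : nat) (i : 'I_m) :
  F_poly (delta_mx i 0 : 'cV[R]_m) = 0.
Proof.
(* A unit step from the origin: with [w = s = 0] the coefficients are 0, 1, -2, 1, with sum 0. *)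
have := F_poly_perturb (0 : 'cV[R]_m) i 1.
rewrite F_poly0 add0r scale1r subr0 => ->.
rewrite /off_norm2 big1 => [|j _]; last by rewrite mxE expr0n.
by rewrite mxE; ring.
Qed.

(** Minimality is asked only along each axis, with its own radius, so the lemma serves both zeros of
    [F_poly] and local minimizers of [f]. *)
Lemma F_poly_coord_min (R : realType) (m : nat) (z : 'cV[R]_m) :
  (forall i, exists2 e, 0 < e &
     forall t, `|t| < e -> F_poly z <= F_poly (z + t *: delta_mx i 0)) ->
  z = 0 \/ exists i, z = delta_mx i 0.
Proof.
move=> h.
have [[i zi0]|z0] := pselect (exists i, z i 0 != 0); last first.
  left; apply/matrixP => i j; rewrite ord1 mxE.
  by apply: contrapT => /eqP zi0; apply: z0; exists i.
right; exists i; have [e e0 he] := h i.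
have [wi si] := F_poly_coord_min_neq0 e0 he zi0.
have zj0 j : j != i -> z j 0 = 0.
  move=> ji; apply: contrapT => /eqP zj0; have [d d0 hd] := h j.
  have [wj _] := F_poly_coord_min_neq0 d0 hd zj0.
  have : z j 0 ^+ 2 <= off_norm2 z i.
    rewrite /off_norm2 (bigD1 j) //= lerDl sumr_ge0 // => k _.
    exact: sqr_ge0.
  rewrite si; nra.
have s0 : off_norm2 z i = 0.
  by rewrite /off_norm2 big1 // => j ji; rewrite zj0 // expr0n.
have zi1 : z i 0 = 1.
  have nz : 2 * z i 0 - 1 != 0 by apply/eqP; lra.
  by apply/eqP; rewrite -subr_eq0; apply/eqP; apply: (mulIf nz); lra.
apply/matrixP => j k; rewrite ord1 mxE andbT.
by have [->//|/zj0] := eqVneq j i.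
Qed.

Lemma F_poly_eq0 (R : realType) (m : nat) (z : 'cV[R]_m) :
  F_poly z = 0 <-> z = 0 \/ exists i, z = delta_mx i 0.
Proof.
split=> [F0|[->|[i ->]]]; [|exact: F_poly0|exact: F_poly_delta].
apply: F_poly_coord_min => i; exists 1 => // t _.
by rewrite F0 F_poly_ge0.
Qed.

(** * The left inverse and the transfer to [f] *)

Lemma row_self_mul_eq0 (R : realFieldType) (n : nat) (y : 'rV[R]_n) :
  y *m y^T = 0 -> y = 0.
Proof.
move=> /matrixP /(_ 0 0); rewrite !mxE.
under eq_bigr do rewrite mxE -expr2.
move=> /eqP; rewrite psumr_eq0 => [/allP y0|j _]; last exact: sqr_ge0.
apply/rowP => j; rewrite mxE; apply/eqP; rewrite -sqrf_eq0.
by apply: y0; rewrite mem_index_enum.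
Qed.

(** If [v *m (U^T *m U) = 0], then [v *m U^T] has zero squared norm, so it vanishes, and full rank
    forces [v = 0]. *)
Lemma gram_unitmx (R : realFieldType) (n m : nat) (U : 'M[R]_(n, m)) :
  \rank U = m -> U^T *m U \in unitmx.
Proof.
move=> rU; have UTfree : row_free U^T by rewrite /row_free mxrank_tr rU.
rewrite -row_free_unit -kermx_eq0; apply/eqP/row_matrixP => i.
rewrite row0; set v := row i _.
have v0 : v *m (U^T *m U) = 0 by apply/sub_kermxP; rewrite row_sub.
apply: (row_free_inj UTfree); rewrite mul0mx.
apply: row_self_mul_eq0.
by rewrite trmx_mul trmxK mulmxA -(mulmxA v) v0 mul0mx.
Qed.

Lemma left_pinvK (R : realType) (n m : nat) (U : 'M[R]_(n, m)) :
  \rank U = m -> left_pinv U *m U = 1%:M.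
Proof. by move=> rU; rewrite /left_pinv -mulmxA mulVmx // gram_unitmx. Qed.

Lemma local_minimizer_line (R : realType) (n : nat) (f : 'cV[R]_n -> R)
    (x v : 'cV[R]_n) : local_minimizer f x ->
  exists2 e, 0 < e & forall t, `|t| < e -> f x <= f (x + t *: v).
Proof.
move=> fx.
have cx : (fun t : R => x + t *: v) @ 0 --> x.
  rewrite -[X in _ --> X]addr0 -(scale0r v).
  by apply: cvgD; [exact: cvg_cst|apply: cvgZr_tmp; exact: cvg_id].
have /nbhs_ballP[e e0 he] := cx _ fx.
exists e => // t te; apply: he.
by rewrite -ball_normE /= sub0r normrN.
Qed.

Theorem theorem4p2 (R : realType) (n m : nat) (u : 'I_m.+1 -> 'cV[R]_n)
    (u_inj : injective u) (le_kn : (m.+1 <= n.+1)%N)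
    (rankU : \rank (diff_mx u) = m) :
  let S := range u in
  let Udag := left_pinv (diff_mx u) in
  let f := fun x : 'cV[R]_n => F_poly (Udag *m (x - u ord_max)) in
  loss_function f [set x + y | x in S & y in null_space Udag] /\
  (forall x, ~ spurious_minimizer f x).
Proof.
move=> S Udag f.
have UdagU : Udag *m diff_mx u = 1%:M by exact: left_pinvK.
have Udag_u (i : 'I_m) :
    Udag *m (u (widen_ord (leqnSn m) i) - u ord_max) = delta_mx i 0.
  have -> : u (widen_ord (leqnSn m) i) - u ord_max = col i (diff_mx u).
    by apply/colP => j; rewrite !mxE.
  by rewrite colE mulmxA UdagU mul1mx.
split; first split=> x.
- exact: F_poly_ge0.
- rewrite /f F_poly_eq0; split.
    move=> [z0|[i zi]].
      exists (u ord_max); first by exists ord_max.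
      by exists (x - u ord_max) => //; rewrite addrC subrK.
    set i' := widen_ord (leqnSn m) i.
    exists (u i'); first by exists i'.
    exists (x - u i'); last by rewrite addrC subrK.
    (* Writing [x - u i'] as [(x - u ord_max) - (u i' - u ord_max)], both terms are sent to
       [delta_mx i 0]. *)
    rewrite /null_space /= -(subrKA (u ord_max)) -[u ord_max - _]opprB.
    by rewrite mulmxDr mulmxN zi Udag_u subrr.
  move=> [_ [i _ <-]] [y y0 <-].
  rewrite addrAC mulmxDr y0 addr0.
  (* An index below [m] names a column of [diff_mx u]; the only other index is the base point
     [ord_max], sent to 0. *)
  have [im|im] := ltnP i m.
    right; exists (Ordinal im); rewrite -Udag_u.
    by congr (_ *m (u _ - _)); apply: val_inj.
  left; have -> : i = ord_max.
    by apply: val_inj => /=; apply/eqP; rewrite eqn_leq im -ltnS ltn_ord.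
  by rewrite subrr mulmx0.
(* A local minimizer with value 0 is global because [f] is nonnegative. *)
- move=> x [fx]; apply=> y; suff -> : f x = 0 by exact: F_poly_ge0.
  apply/F_poly_eq0; apply: F_poly_coord_min => i.
  have [e e0 he] := local_minimizer_line (col i (diff_mx u)) fx.
  exists e => // t te; have := he t te.
  rewrite /f addrAC [Udag *m (_ + _ *: _)]mulmxDr -scalemxAr.
  by rewrite colE mulmxA UdagU mul1mx.
Qed.
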